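(* Let $(S,\tau)$ be a Hausdorff semitopological $\mathsf{OIP}$-semigroup. Then there exists a topological $\mathbb{Z}$-Bruck extension $(\mathscr{B}(S,\mathbb{Z}),\tau_{\mathbf{BR}})$ of $(S,\tau)$ in the class of semitopological semigroups such that the topology $\tau_{\mathbf{BR}}$ is strictly coarser than the direct sum topology $\tau_{\mathbf{BR}}^{\mathbf{ds}}$ on $\mathscr{B}(S,\mathbb{Z})$.
   Context: All topological spaces are Hausdorff. A semitopological semigroup is a (Hausdorff) topological space with a separately continuous semigroup operation. Ideals are two-sided and nonempty. Convention: $S$ always has a unit $1_S$; a semigroup without unit is replaced by the monoid $S^1$ obtained by adjoining an isolated unit, so $S=S^1$. A semitopological semigroup $S$ is an $\mathsf{OIP}$-semigroup (has the open ideal property) if there is a family $\mathscr{I}=\{I_\alpha\}_{\alpha\in\mathcal{A}}$ of open ideals in $S$ such that for every $x\in S$ there exist $I_\alpha\in\mathscr{I}$ and an open neighbourhood $U(x)$ of $x$ in $S$ with $U(x)\cap I_\alpha=\varnothing$. The $\mathbb{Z}$-Bruck extension $\mathscr{B}(S,\mathbb{Z})$ is the set $\mathbb{Z}\times S\times\mathbb{Z}$ with the semigroup operation $$(i,s,j)\cdot(m,t,n)=\begin{cases}(i-j+m,t,n), & j<m,\\ (i,s\cdot t,n), & j=m,\\ (i,s,n-m+j), & j>m.\end{cases}$$ For $m,n\in\mathbb{Z}$ put $S_{m,n}=\{(m,s,n)\colon s\in S\}$. The direct sum topology $\tau_{\mathbf{BR}}^{\mathbf{ds}}$ is the product topology on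 $\mathbb{Z}\times S\times\mathbb{Z}$ with $\mathbb{Z}$ discrete, i.e. the topology with base $\{\{i\}\times U\times\{j\}\colon U\in\tau,\ i,j\in\mathbb{Z}\}$. A topological $\mathbb{Z}$-Bruck extension of $(S,\tau)$ in a class $\mathfrak{S}$ of semitopological semigroups (with $(S,\tau)\in\mathfrak{S}$) is a semigroup $(\mathscr{B}(S,\mathbb{Z}),\tau_{\mathbf{BR}})\in\mathfrak{S}$ such that, for some $m\in\mathbb{Z}$, the restriction of $\tau_{\mathbf{BR}}$ to $S_{m,m}$ coincides with $\tau$ under the identification $(m,s,m)\leftrightarrow s$. *)

(* Defs.v *)
From HB Require Import structures.
From mathcomp Require Import all_boot all_order all_algebra.
From mathcomp Require Import boolp classical_sets topology.

Set Implicit Arguments.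
Unset Strict Implicit.
Unset Printing Implicit Defensive.

Import Order.TTheory GRing.Theory Num.Theory.
Local Open Scope classical_set_scope.
Local Open Scope ring_scope.

(* A class of semitopological semigroups is a predicate on pairs of a
   topological space and a binary operation on it. *)
Definition semigroup_class := forall T : topologicalType, (T -> T -> T) -> Prop.

Definition separately_continuous (T : topologicalType) (op : T -> T -> T) :=
  (forall a, continuous (fun x => op a x)) /\
  (forall a, continuous (fun x => op x a)).

Definition semitopological_semigroup : semigroup_class := fun T op =>
  [/\ hausdorff_space T, associative op & separately_continuous op].
Arguments semitopological_semigroup : clear implicits.

Definition ideal (T : Type) (op : T -> T -> T) (I : set T) :=
  I !=set0 /\ forall x s, I x -> I (op s x) /\ I (op x s).

Definition open_ideal_property (T : topologicalType) (op : T -> T -> T) :=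
  exists F : set (set T),
    (forall I, F I -> open I /\ ideal op I) /\
    (forall x, exists I U, [/\ F I, open U, U x & U `&` I = set0]).

Definition OIP_semigroup : semigroup_class := fun T op =>
  semitopological_semigroup T op /\ open_ideal_property op.
Arguments OIP_semigroup : clear implicits.

(* Topologies on a fixed type are compared through their [Topological]
   structures; the [choiceType] component these carry plays no role. *)
Definition coarser (T : Type) (t1 t2 : Topological T) :=
  forall W : set T,
    @open (Topological.Pack t1) W -> @open (Topological.Pack t2) W.

Definition strictly_coarser (T : Type) (t1 t2 : Topological T) :=
  coarser t1 t2 /\ ~ coarser t2 t1.

(* The Z-Bruck extension: ((i, s), j) stands for the triple (i, s, j). *)
Definition bruckZ (S : Type) : Type := (int * S * int)%type.

Definition bruckZ_mul (S : Type) (mul : S -> S -> S) (x y : bruckZ S) :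
    bruckZ S :=
  let: (i, s, j) := x in
  let: (m, t, n) := y in
  if j < m then (i - j + m, t, n)
  else if j == m then (i, mul s t, n)
  else (i, s, n - m + j).

Definition bruckZ_in (S : Type) (m n : int) (s : S) : bruckZ S := (m, s, n).

Definition bruckZ_ds (S : topologicalType) : Topological (bruckZ S) :=
  Topological.class (discrete_topology int * S * discrete_topology int)%type.

Definition topological_bruckZ_extension (K : semigroup_class)
    (S : topologicalType) (mul : S -> S -> S) (tau : Topological (bruckZ S)) :=
  [/\ K S mul,
      K (Topological.Pack tau) (bruckZ_mul mul) &
      exists m : int, forall U : set S,
        open U <->
        exists2 W : set (bruckZ S), @open (Topological.Pack tau) W
          & W `&` range (@bruckZ_in S m m) = @bruckZ_in S m m @` U].

(* Main.v *)
Require Import Defs.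
From HB Require Import structures.
From mathcomp Require Import boot.ssreflect boot.ssrfun topology.
From mathcomp Require Import all_boot all_order all_algebra zify.
From mathcomp Require Import boolp classical_sets functions.

(** The topology is the direct sum topology, weakened only at the points
(i, e, j) over the unit e of S: a neighbourhood of (i, e, j) has to contain,
besides a neighbourhood of e placed in S_{i,j}, a copy of some open ideal I in
S_{i-1,j-1}. All other points keep their direct sum neighbourhoods.

The translations stay continuous because multiplying on the left by (m, t, n)
does one of three things to the copy of I in S_{i-1,j-1}. If n < i - 1, the
copy is moved together with S_{i,j} to a copy attached to the image of
(i, e, j). If n = i - 1, it is moved inside such a copy, as t I is contained
in I. If n >= i, it is collapsed to a single point, and this point is the
image of (i, e, j) itself: for n = i this says (m, t e, j) = (m, t, j). This
last case is why the unit is the only element at which S_{i-1,j-1} can be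
glued to S_{i,j}. Right translations follow from left ones through the
anti-isomorphism (i, s, j) -> (j, s, i), which exchanges B(S, Z) and
B(S^op, Z).

The open ideal property enters twice. It supplies a proper open ideal, so that
neighbourhoods of (i, e, j) can be chosen not to reach the unit of
S_{i-1,j-1} and spread further down the diagonal; and it makes the topology
Hausdorff, since a point of S_{i-1,j-1} is separated from (i, e, j) exactly
when it has a neighbourhood in S disjoint from some open ideal. Finally,
S_{0,0} is open in the direct sum topology but not in the new one, because
ideals are nonempty. *)

Set Implicit Arguments.
Unset Strict Implicit.
Unset Printing Implicit Defensive.

Import Order.TTheory GRing.Theory Num.Theory.
Local Open Scope classical_set_scope.
Local Open Scope ring_scope.

(** * Multiplication in the Z-Bruck extension *)

Lemma bruckZ_mul_lt (S : Type) (mul : S -> S -> S) (i j m n : int) (s t : S) :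
  j < m -> bruckZ_mul mul (i, s, j) (m, t, n) = (i - j + m, t, n).
Proof. by rewrite /bruckZ_mul => ->. Qed.

Lemma bruckZ_mul_eq (S : Type) (mul : S -> S -> S) (i j n : int) (s t : S) :
  bruckZ_mul mul (i, s, j) (j, t, n) = (i, mul s t, n).
Proof. by rewrite /bruckZ_mul ltxx eqxx. Qed.

Lemma bruckZ_mul_gt (S : Type) (mul : S -> S -> S) (i j m n : int) (s t : S) :
  m < j -> bruckZ_mul mul (i, s, j) (m, t, n) = (i, s, n - m + j).
Proof. by move=> ltmj; rewrite /bruckZ_mul ltNge (ltW ltmj) gt_eqF. Qed.

Lemma bruckZ_mulA (S : Type) (mul : S -> S -> S) :
  associative mul -> associative (bruckZ_mul mul).
Proof.
move=> mulA [[i s] j] [[k t] l] [[m u] n]; rewrite /bruckZ_mul.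
case: (ltgtP j k) => jk; case: (ltgtP l m) => lm /=;
  repeat (case: ltgtP => ? /=); rewrite ?mulA;
  by [exfalso; lia | congr (_, _, _); lia].
Qed.

(** * The topology *)

Definition bruckZ_open (S : topologicalType) (mul : S -> S -> S) (e : S)
    (W : set (bruckZ S)) :=
  (forall i j, open (@bruckZ_in S i j @^-1` W)) /\
  (forall i j, W (i, e, j) -> exists I : set S,
     [/\ open I, ideal mul I & I `<=` @bruckZ_in S (i - 1) (j - 1) @^-1` W]).

Lemma idealT (S : Type) (mul : S -> S -> S) (e : S) : ideal mul setT.
Proof. by split; first by exists e. Qed.

(** The product of an element of I and an element of J witnesses that the
intersection is nonempty; this is what makes finite intersections of open sets
open below. *)
Lemma idealI (S : Type) (mul : S -> S -> S) (I J : set S) :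
  ideal mul I -> ideal mul J -> ideal mul (I `&` J).
Proof.
move=> [[x Ix] idI] [[y Jy] idJ]; split.
  by exists (mul x y); split; [exact: (idI _ _ Ix).2|exact: (idJ _ _ Jy).1].
move=> z s [Iz Jz]; have [? ?] := idI _ s Iz; have [? ?] := idJ _ s Jz.
by [].
Qed.

Lemma bruckZ_openT (S : topologicalType) (mul : S -> S -> S) (e : S) :
  bruckZ_open mul e setT.
Proof.
split=> [i j|i j _]; first exact: openT.
by exists setT; split=> //; [exact: openT|exact: idealT].
Qed.

Lemma bruckZ_openI (S : topologicalType) (mul : S -> S -> S) (e : S) :
  setI_closed (bruckZ_open mul e).
Proof.
move=> V W [oV idV] [oW idW]; split=> [i j|i j [/idV [I [oI iI IV]] /idW]].
  by rewrite preimage_setI; apply: openI.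
move=> [J [oJ iJ JW]]; exists (I `&` J).
by split; [exact: openI|exact: idealI|exact: setISS].
Qed.

Lemma bruckZ_open_bigU (S : topologicalType) (mul : S -> S -> S) (e : S)
    (A : Type) (W : A -> set (bruckZ S)) :
  (forall a, bruckZ_open mul e (W a)) -> bruckZ_open mul e (\bigcup_a W a).
Proof.
move=> oW; split=> [i j|i j [a _ Wa]].
  by rewrite preimage_bigcup; apply: bigcup_open => a _; exact: (oW a).1.
have [I [oI iI IW]] := (oW a).2 _ _ Wa.
by exists I; split=> // x /IW Wx; exists a.
Qed.

(** A copy of the carrier, so that the topology below does not compete with the
product topology on triples. *)
Definition bruckZ_ideal_space (S : topologicalType) (mul : S -> S -> S)
  (e : S) : Type := bruckZ S.

HB.instance Definition _ (S : topologicalType) (mul : S -> S -> S) (e : S) :=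
  Choice.copy (bruckZ_ideal_space mul e) (int * S * int)%type.

HB.instance Definition _ (S : topologicalType) (mul : S -> S -> S) (e : S) :=
  isOpenTopological.Build (bruckZ_ideal_space mul e) (bruckZ_openT mul e)
    (@bruckZ_openI S mul e) (@bruckZ_open_bigU S mul e).

Lemma bruckZ_openE (S : topologicalType) (mul : S -> S -> S) (e : S)
    (W : set (bruckZ_ideal_space mul e)) : open W = bruckZ_open mul e W.
Proof. by []. Qed.

(** * Open sets concentrated on two consecutive pieces *)

Definition bruckZ_nbhd (S : Type) (i j : int) (U I : set S) : set (bruckZ S) :=
  @bruckZ_in S i j @` U `|` @bruckZ_in S (i - 1) (j - 1) @` I.

Lemma bruckZ_in_image (S : Type) (i j p q : int) (U : set S) (x : S) :
  (@bruckZ_in S i j @` U) (p, x, q) <-> [/\ p = i, q = j & U x].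
Proof. by split=> [[y Uy [<- <- <-]]|[-> -> Ux]]; last by exists x. Qed.

Lemma bruckZ_nbhdE (S : Type) (i j p q : int) (U I : set S) (x : S) :
  bruckZ_nbhd i j U I (p, x, q) <->
  [/\ p = i, q = j & U x] \/ [/\ p = i - 1, q = j - 1 & I x].
Proof.
by split=> -[/bruckZ_in_image ?|/bruckZ_in_image ?]; [left|right|left|right].
Qed.

Lemma open_slice (S : topologicalType) (i j : int) (U : set S) : open U ->
  forall p q, open (@bruckZ_in S p q @^-1` (@bruckZ_in S i j @` U)).
Proof.
move=> oU p q; have [[pi qj]|npq] := pselect (p = i /\ q = j).
  rewrite (_ : _ @^-1` _ = U) //; apply/seteqP.
  by split=> x => [/bruckZ_in_image[]|Ux] //; exact/bruckZ_in_image.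
rewrite (_ : _ @^-1` _ = set0); first exact: open0.
by apply/seteqP; split=> x //= /bruckZ_in_image [pi qj _]; apply: npq.
Qed.

(** When e is not in I, the set stops at level (i - 1, j - 1): it contains no
unit there, so no ideal is required at level (i - 2, j - 2). When e is not in
U either, I may be any open set, in particular empty. *)
Lemma open_bruckZ_nbhd (S : topologicalType) (mul : S -> S -> S) (e : S)
    (i j : int) (U I : set S) :
  open U -> open I -> ~ I e -> (U e -> ideal mul I) ->
  bruckZ_open mul e (bruckZ_nbhd i j U I).
Proof.
move=> oU oI nIe idI; split=> [p q|p q /bruckZ_nbhdE [|[_ _ //]]].
  by rewrite preimage_setU; apply: openU; exact: open_slice.
move=> [-> -> Ue]; exists I; split=> //; first exact: idI.
by move=> x Ix; apply/bruckZ_nbhdE; right.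
Qed.

(** * The Hausdorff property *)

(** A single ideal can be used for s, t and e at once, by intersecting the three
ideals that the open ideal property provides. *)
Lemma OIP_avoid (S : topologicalType) (mul : S -> S -> S) (e s t : S) :
  open_ideal_property mul ->
  exists I U V : set S, [/\ [/\ open I, ideal mul I & ~ I e],
    [/\ open U, U s & U `&` I = set0] & [/\ open V, V t & V `&` I = set0]].
Proof.
move=> [F [FP oip]].
have [I [U [/FP [oI iI] oU Us /disjoints_subset UI]]] := oip s.
have [J [V [/FP [oJ iJ] oV Vt /disjoints_subset VJ]]] := oip t.
have [K [N [/FP [oK iK] _ Ne /disjoints_subset NK]]] := oip e.
exists (I `&` J `&` K), U, V; split; split=> //.
- by apply: openI => //; exact: openI.
- by apply: idealI => //; exact: idealI.
- by move=> [_ /(NK _ Ne)].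
- by apply/disjoints_subset => x /UI nIx [[]].
- by apply/disjoints_subset => x /VJ nJx [[]].
Qed.

(** Points in different pieces are separated by neighbourhoods of s and t that
both miss the ideal I, used below both of them. Inside one piece the two copies
of I would meet, but disjoint neighbourhoods A and B cannot both contain e, so
at most one of them needs an ideal below it. *)
Lemma bruckZ_ideal_hausdorff (S : topologicalType) (mul : S -> S -> S)
    (e : S) :
  hausdorff_space S -> open_ideal_property mul ->
  hausdorff_space (bruckZ_ideal_space mul e).
Proof.
move=> hS oip; rewrite open_hausdorff => -[[i s] j] [[m t] n] neq.
have [I [U [V [[oI iI nIe] [oU Us UI] [oV Vt VI]]]]] := OIP_avoid e s t oip.
have inn (p q : int) (x : S) (A B : set S) : A x ->
    ((p, x, q) : bruckZ_ideal_space mul e) \in bruckZ_nbhd p q A B.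
  by move=> Ax; apply/mem_set/bruckZ_nbhdE; left.
have [[im jn]|nij] := pselect (i = m /\ j = n); last first.
  exists (bruckZ_nbhd i j U I, bruckZ_nbhd m n V I); first by split; exact: inn.
  split=> /=; [exact: open_bruckZ_nbhd|exact: open_bruckZ_nbhd|].
  apply/eqP/disjoints_subset => -[[p x] q].
  move=> /bruckZ_nbhdE A /bruckZ_nbhdE B.
  have nUI : ~ (U x /\ I x) by move=> ?; suff : (U `&` I) x by rewrite UI.
  have nVI : ~ (V x /\ I x) by move=> ?; suff : (V `&` I) x by rewrite VI.
  move: A B nUI nVI => [[? ? ?]|[? ? ?]] [[? ? ?]|[? ? ?]] nUI nVI.
  - by apply: nij; split; lia.
  - exact: nUI.
  - exact: nVI.
  - by apply: nij; split; lia.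
subst m n; have {neq} nst : s != t by apply: contra_neq neq => ->.
move: hS; rewrite open_hausdorff => /(_ _ _ nst) [[A B]] /=.
move=> [/set_mem As /set_mem Bt] [oA oB /eqP/disjoints_subset AB].
(* Below a set without the unit, nothing is attached. *)
pose J (X : set S) := if `[<X e>] then I else set0.
have oJ X : open X -> bruckZ_open mul e (bruckZ_nbhd i j X (J X)).
  move=> oX; apply: open_bruckZ_nbhd; rewrite // /J; case: asboolP => // _.
    exact: open0.
  exact.
exists (bruckZ_nbhd i j A (J A), bruckZ_nbhd i j B (J B)).
  by split; exact: inn.
split=> /=; [exact: oJ|exact: oJ|apply/eqP/disjoints_subset => -[[p x] q]].
rewrite /J => /bruckZ_nbhdE [[pi qj Ax]|[pi qj JAx]].
  by move=> /bruckZ_nbhdE [[_ _]|[pi' _ _]]; [exact: AB|lia].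
move=> /bruckZ_nbhdE [[pi' _ _]|[_ _]]; first lia.
by move: JAx; do 2 case: asboolP => //; move=> Be Ae _ _; exact: (AB _ Ae).
Qed.

(** * Separate continuity *)

Lemma bruckZ_mull_continuous (S : topologicalType) (mul : S -> S -> S) (e : S) :
  right_id e mul -> (forall t, continuous (mul t)) ->
  let T : topologicalType := bruckZ_ideal_space mul e in
  forall a : T, continuous (bruckZ_mul mul a : T -> T).
Proof.
move=> mul1 cmul T [[m t] n]; apply/continuousP => W openW.
have [oW idW] : bruckZ_open mul e W := openW.
split=> [p q|p q].
  have [np|pn|<-] := ltgtP n p.
  - rewrite (_ : _ @^-1` _ = @bruckZ_in S (m - n + p) q @^-1` W).
      exact: oW.
    by apply: funext => x; exact: (congr1 W (bruckZ_mul_lt _ _ _ _ _ np)).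
  - rewrite (_ : _ @^-1` _ = cst ((m, t, q - p + n) : T) @^-1` W).
      by move/continuousP: (@cst_continuous S T (m, t, q - p + n)); exact.
    by apply: funext => x; exact: (congr1 W (bruckZ_mul_gt _ _ _ _ _ pn)).
  - rewrite (_ : _ @^-1` _ = mul t @^-1` (@bruckZ_in S m q @^-1` W)).
      by move/continuousP: (cmul t); exact.
    by apply: funext => x; exact: (congr1 W (bruckZ_mul_eq _ _ _ _ _ _)).
rewrite [X in X -> _]/preimage /mkset => Wp.
have [pn|np] := leP p n.
  (* The whole piece S_{p-1,q-1} is sent to the image of (p, e, q). *)
  exists setT; split; [exact: openT|exact: idealT|move=> x _].
  change (W (bruckZ_mul mul (m, t, n) (p - 1, x, q - 1))).
  rewrite bruckZ_mul_gt; last lia.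
  have -> : q - 1 - (p - 1) + n = q - p + n by lia.
  move: pn Wp; rewrite le_eqVlt => /predU1P [->|pn].
    by rewrite bruckZ_mul_eq mul1 subrK.
  by rewrite bruckZ_mul_gt.
move: Wp; rewrite bruckZ_mul_lt // => /idW [I [oI iI IW]].
exists I; split=> // x Ix.
change (W (bruckZ_mul mul (m, t, n) (p - 1, x, q - 1))).
have [n1p|pn1|n1p] := ltgtP n (p - 1); [|lia|].
  by rewrite bruckZ_mul_lt // addrA; exact: IW.
rewrite -n1p bruckZ_mul_eq.
suff <- : m - n + p - 1 = m by apply: IW; exact: (iI.2 _ _ Ix).1.
by rewrite -addrA -n1p subrK.
Qed.

(** The anti-isomorphism between B(S, Z) and B(S^op, Z). *)
Definition bruckZ_flip (S : Type) (x : bruckZ S) : bruckZ S :=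
  (x.2, x.1.2, x.1.1).

Lemma bruckZ_flipK (S : Type) : involutive (@bruckZ_flip S).
Proof. by move=> [[i s] j]. Qed.

Lemma bruckZ_flipM (S : Type) (mul : S -> S -> S) (x y : bruckZ S) :
  bruckZ_flip (bruckZ_mul mul x y) =
  bruckZ_mul (fun s t => mul t s) (bruckZ_flip y) (bruckZ_flip x).
Proof.
case: x y => [[i s] j] [[m t] n]; rewrite /bruckZ_flip /=.
by case: ltgtP => /=.
Qed.

(** The topology is self-dual: two-sided ideals are the same for S and S^op, and
the flip preserves the diagonals along which the pieces are glued. *)
Lemma bruckZ_open_flip (S : topologicalType) (mul : S -> S -> S) (e : S)
    (W : set (bruckZ S)) :
  bruckZ_open mul e W ->
  bruckZ_open (fun s t => mul t s) e (@bruckZ_flip S @^-1` W).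
Proof.
move=> [oW idW]; split=> [i j|i j /idW [I [oI [I0 iI] IW]]]; first exact: oW.
exists I; split=> //; split=> // x s Ix.
by have [? ?] := iI _ s Ix.
Qed.

Lemma bruckZ_mulr_continuous (S : topologicalType) (mul : S -> S -> S) (e : S) :
  left_id e mul -> (forall t, continuous (mul^~ t)) ->
  let T : topologicalType := bruckZ_ideal_space mul e in
  forall a : T, continuous ((bruckZ_mul mul)^~ a : T -> T).
Proof.
move=> mul1 cmul T a; apply/continuousP => W; rewrite !bruckZ_openE => oW.
pose op s t := mul t s.
have /continuousP /(_ _ (bruckZ_open_flip oW)) /bruckZ_open_flip :=
  @bruckZ_mull_continuous S op e mul1 cmul (bruckZ_flip a).
congr bruckZ_open; apply: funext => x.
apply: (congr1 W (_ : _ = bruckZ_mul mul x a)).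
by rewrite -[RHS]bruckZ_flipK (bruckZ_flipM mul).
Qed.

(** * Comparison with the topology of S and the direct sum topology *)

Lemma bruckZ_ideal_trace (S : topologicalType) (mul : S -> S -> S) (e : S)
    (m : int) (U : set S) : open_ideal_property mul ->
  open U <-> exists2 W : set (bruckZ_ideal_space mul e), open W
    & W `&` range (@bruckZ_in S m m) = @bruckZ_in S m m @` U.
Proof.
move=> oip; split=> [oU|[W oW /seteqP [WU UW]]].
  have [I [_ [_ [[oI iI nIe] _ _]]]] := OIP_avoid e e e oip.
  exists (bruckZ_nbhd m m U I); first exact: open_bruckZ_nbhd.
  apply/seteqP; split=> [_ [/[swap] [[x _ <-]]] /bruckZ_nbhdE|_ [x Ux <-]].
    by move=> [[_ _ Ux]|[]]; [exists x|lia].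
  by split; [apply/bruckZ_nbhdE; left|exists x].
rewrite (_ : U = @bruckZ_in S m m @^-1` W); first exact: oW.1.
apply/seteqP; split=> x.
  by move=> Ux; apply: (UW (m, x, m) _).1; exists x.
move=> Wx; have [|y Uy [<- //]] := WU (m, x, m).
by split=> //; exists x.
Qed.

Lemma bruckZ_ds_open (S : topologicalType) (W : set (bruckZ S)) :
  (forall i j, open (@bruckZ_in S i j @^-1` W)) ->
  @open (Topological.Pack (bruckZ_ds S)) W.
Proof.
move=> oW.
change (@open (discrete_topology int * S * discrete_topology int)%type W).
rewrite openE => -[[i s] j] Wx; rewrite /interior.
exists ([set i] `*` (@bruckZ_in S i j @^-1` W), [set j]).
  split; last exact: (@discrete_set1 (discrete_topology int)).
  exists ([set i], @bruckZ_in S i j @^-1` W) => //.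
  split; first exact: (@discrete_set1 (discrete_topology int)).
  by apply: open_nbhs_nbhs; split; first exact: oW.
by move=> [[p x] q] [/= [-> ?] ->].
Qed.

Theorem theorem2p11 (S : topologicalType) (mul : S -> S -> S) (e : S)
    (mul1s : left_id e mul) (muls1 : right_id e mul)
    (oipS : OIP_semigroup S mul) :
  exists tau : Topological (bruckZ S),
    topological_bruckZ_extension semitopological_semigroup mul tau /\
    strictly_coarser tau (bruckZ_ds S).
Proof.
have [[hS mulA [cmul cmulr]] oip] := oipS.
exists (Topological.class (bruckZ_ideal_space mul e)); split; split.
- by [].
- split; [exact: bruckZ_ideal_hausdorff|exact: bruckZ_mulA|split].
    exact: bruckZ_mull_continuous.
  exact: bruckZ_mulr_continuous.
- by exists 0 => U; exact: bruckZ_ideal_trace.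
- by move=> W [oW _]; exact: bruckZ_ds_open.
(* S_{0,0} contains the unit (0, e, 0) but no copy of an ideal in S_{-1,-1}. *)
move=> /(_ (@bruckZ_in S 0 0 @` setT)) [].
  exact/bruckZ_ds_open/open_slice/openT.
move=> _ /(_ 0 0) [|I [_ [[x Ix] _] IW]]; first by exists e.
by have [] := IW _ Ix.
Qed.
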